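(* For every permutation graph $G$, $\mathrm{fun}(G)\le 8$.
   Context: All graphs are finite, simple (undirected, no loops, no multiple edges), with nonempty vertex set. For a graph $G=(V,E)$ let $A(x,y)=1$ if $x,y\in V$ are adjacent and $A(x,y)=0$ otherwise. Functionality: a vertex $y\in V$ is a function of vertices $x_1,\dots,x_k\in V\setminus\{y\}$ if there exists a Boolean function $f:\{0,1\}^k\to\{0,1\}$ such that for every $z\in V\setminus\{y,x_1,\dots,x_k\}$, $A(y,z)=f(A(x_1,z),\dots,A(x_k,z))$. The functionality $\mathrm{fun}(y)$ of $y$ (in $G$) is the minimum $k\ge 0$ such that $y$ is a function of some $k$ vertices. The functionality of the graph is $\mathrm{fun}(G)=\max_H\min_{y\in V(H)}\mathrm{fun}(y)$, where the maximum is over all (nonempty) induced subgraphs $H$ of $G$ and $\mathrm{fun}(y)$ is computed in $H$. The permutation graph of a permutation $\pi$ of $\{1,2,\dots,n\}$ is the graph with vertex set $\{1,2,\dots,n\}$ in which $i$ and $j$ are adjacent if and only if $(i-j)(\pi(i)-\pi(j))<0$. A permutation graph is a graph isomorphic to the permutation graph of some permutation. *)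

(* Defs.v *)
From HB Require Import structures.
From mathcomp Require Import all_boot all_order all_fingroup all_algebra.

Set Implicit Arguments.
Unset Strict Implicit.
Unset Printing Implicit Defensive.

Import Order.TTheory GRing.Theory Num.Theory.

Record sgraph := SGraph {
  vertex :> finType;
  adj : rel vertex;
  adj_sym : symmetric adj;
  adj_irrefl : irreflexive adj;
  vertex_nonempty : 0 < #|vertex|
}.

Definition graph_iso (G H : sgraph) : Prop :=
  exists2 f : G -> H, bijective f & forall x y, adj (f x) (f y) = adj x y.

Section Induced.
Variables (G : sgraph) (S : {S : {set G} | S != set0}).

Definition induced_vertex : finType := {x : G | x \in val S}.
Definition induced_adj : rel induced_vertex := fun x y => adj (val x) (val y).

Lemma induced_adj_sym : symmetric induced_adj.
Proof. by move=> x y; apply: adj_sym. Qed.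

Lemma induced_adj_irrefl : irreflexive induced_adj.
Proof. by move=> x; apply: adj_irrefl. Qed.

Lemma induced_nonempty : 0 < #|induced_vertex|.
Proof. by rewrite card_sig card_gt0 (valP S). Qed.

Definition induced : sgraph :=
  SGraph induced_adj_sym induced_adj_irrefl induced_nonempty.
End Induced.

(* The x_i need not be distinct: dropping repetitions only lowers k, so the
   minimum below does not depend on this. *)
Definition is_function_of (G : sgraph) (y : G) (k : nat) (x : k.-tuple G) :
    bool :=
  (y \notin x) &&
  [exists f : {ffun k.-tuple bool -> bool},
    [forall z : G, (z != y) && (z \notin x) ==>
      (adj y z == f [tuple adj (tnth x i) z | i < k])]].

Definition function_of_some (G : sgraph) (y : G) (k : nat) : bool :=
  [exists x : k.-tuple G, is_function_of y x].

Lemma ex_function_of_some (G : sgraph) (y : G) :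
  exists k, function_of_some y k.
Proof.
exists (size (enum (predC1 y))); apply/existsP; exists (in_tuple _).
apply/andP; split; first by rewrite mem_enum !inE eqxx.
apply/existsP; exists [ffun=> true]; apply/forallP => z.
by rewrite mem_enum !inE andbN.
Qed.

Definition vertex_functionality (G : sgraph) (y : G) : nat :=
  ex_minn (ex_function_of_some y).

Lemma ex_vertex_functionality (G : sgraph) :
  exists k, [exists y : G, vertex_functionality y == k].
Proof.
have /card_gt0P[y _] := vertex_nonempty G.
by exists (vertex_functionality y); apply/existsP; exists y.
Qed.

Definition min_vertex_functionality (G : sgraph) : nat :=
  ex_minn (ex_vertex_functionality G).

Definition functionality (G : sgraph) : nat :=
  \max_(S : {S : {set G} | S != set0}) min_vertex_functionality (induced S).

(* 'S_n.+1 permutes {0, ..., n} rather than {1, ..., n+1}; only differences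
   matter. Subtractions are taken in int. *)
Section PermGraph.
Variables (n : nat) (s : 'S_n.+1).

Definition perm_adj : rel 'I_n.+1 := fun i j =>
  ((i%:Z - j%:Z) * ((s i)%:Z - (s j)%:Z) < 0)%R.

Lemma perm_adj_sym : symmetric perm_adj.
Proof.
by move=> i j; rewrite /perm_adj -(opprB j%:Z%R) -(opprB (s j)%:Z%R) mulrNN.
Qed.

Lemma perm_adj_irrefl : irreflexive perm_adj.
Proof. by move=> i; rewrite /perm_adj !subrr mulr0 ltxx. Qed.

Lemma perm_nonempty : 0 < #|'I_n.+1|.
Proof. by rewrite card_ord. Qed.

Definition perm_graph : sgraph :=
  SGraph perm_adj_sym perm_adj_irrefl perm_nonempty.
End PermGraph.

Definition is_permutation_graph (G : sgraph) : Prop :=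
  exists (n : nat) (s : 'S_n.+1), graph_iso G (perm_graph s).

(* Main.v *)
Require Import Defs.
From mathcomp Require Import all_boot all_fingroup all_algebra zify.

Set Implicit Arguments.
Unset Strict Implicit.
Unset Printing Implicit Defensive.

(**
Draw the vertices as points of the plane, with distinct abscissas p and distinct
ordinates q, so that x and z are adjacent iff p and q order them differently.
Suppose that l < x < r are close in abscissa and monotone (increasing or
decreasing) in ordinate.  For z outside the vertical strip from l to r, if z has
the same adjacency to l and r then x shares it, and otherwise the adjacency to l
tells whether z is to the left or to the right of x.  So the at most four other
points of the strip determine the adjacency of z to x or the side of z.  If this
also holds with p and q exchanged, the two sets of four points determine the
adjacency of z to x.  It fails for p only if the ordinate of x is an extremum
among the points at horizontal distance at most 3; maxima of this kind are at
distance at least 4 from each other, and so are minima, which makes less than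
half of all points.  The same bound with p and q exchanged leaves a good point.
*)

Section FunctionalityBound.
Variables (G : sgraph) (y : G) (S : {set G}).

Lemma vertex_functionality_le_card :
    y \notin S ->
    (forall z z', z != y -> z' != y -> z \notin S -> z' \notin S ->
       {in S, forall s, adj s z = adj s z'} -> adj y z = adj y z') ->
  vertex_functionality y <= #|S|.
Proof.
move=> yS detS; rewrite /vertex_functionality; case: ex_minnP => m _; apply.
apply/existsP; rewrite cardE; exists (in_tuple (enum S)).
apply/andP; split; first by rewrite /= mem_enum.
pose pat z := [tuple adj (tnth (in_tuple (enum S)) i) z | i < size (enum S)].
(* The function sends a pattern to true when some vertex outside realizes it and is adjacent to [y];
   by [detS] the choice of that vertex is immaterial. *)
apply/existsP; exists [ffun t => [exists z, [&& z != y, z \notin S,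
  pat z == t & adj y z]]].
apply/forallP=> z; apply/implyP=> /andP[zy]; rewrite /= mem_enum => zS.
rewrite ffunE; apply/eqP; apply/idP/existsP => [yz|[z' /and4P[z'y z'S /eqP patE yz']]].
  by exists z; rewrite zy zS yz eqxx.
rewrite (detS z z') // => s sS.
have s_lt : index s (enum S) < size (enum S) by rewrite index_mem mem_enum.
have /(congr1 (fun t => tnth t (Ordinal s_lt))) := patE.
by rewrite !tnth_mktuple (tnth_nth s) /= nth_index ?mem_enum.
Qed.

End FunctionalityBound.

Section Points.
Variables (T : finType).
Implicit Types (p q : T -> nat) (x z : T) (e : rel nat).

Definition crossing p q x z := (p x < p z) (+) (q x < q z).

(** For injective [p] the ranks fill 0, ..., [#|T|] - 1 without gaps, so differences of positions
    count points. *)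
Definition rank p x := #|[set z | p z < p x]|.

Lemma rank_lt_card p x : rank p x < #|T|.
Proof.
rewrite -cardsT; apply/proper_card/properP; split=> //.
by exists x; rewrite ?inE ?ltnn.
Qed.

Lemma rank_ltE p x z : (rank p x < rank p z) = (p x < p z).
Proof.
have mono u v : p u <= p v -> rank p u <= rank p v.
  move=> puv; apply/subset_leq_card/subsetP=> w; rewrite !inE => pwu.
  exact: leq_trans pwu puv.
case: (ltnP (p x)) => [pxz|/mono]; last by lia.
apply/proper_card/properP; split; last by exists x; rewrite inE // ltnn.
by apply/subsetP=> w; rewrite !inE => pwx; exact: ltn_trans pwx pxz.
Qed.

Lemma rank_inj p : injective p -> injective (rank p).
Proof.
move=> p_inj x z rxz; apply: p_inj.
by have := rank_ltE p x z; have := rank_ltE p z x; rewrite rxz !ltnn; lia.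
Qed.

Lemma card_window p (A : {set T}) a m :
  injective p -> {in A, forall z, a <= p z < a + m} -> #|A| <= m.
Proof.
move=> p_inj Aw; rewrite -(size_iota a m) cardE -(size_map p).
apply: uniq_leq_size; first by rewrite map_inj_uniq // enum_uniq.
by move=> _ /mapP[z + ->]; rewrite mem_enum mem_iota => /Aw.
Qed.

Definition near p : rel T := fun x z => (p z <= p x + 3) && (p x <= p z + 3).

(** Points within three positions of an end are left out: [ex_determining_set] handles them
    directly. *)
Definition extremal p q e :=
  [set x | [&& 3 <= p x, p x + 3 < #|T| &
            [forall z, near p x z ==> e (q z) (q x)]]].

(** The blocks {[p x], ..., [p x + 3]} of extremal [x] lie in {3, ..., [#|T|] - 1}. They are
    disjoint: if two blocks meet, their points are near each other, so [e] relates their ordinates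
    both ways and antisymmetry identifies them. *)
Lemma card_extremal p q e :
  injective p -> injective q -> antisymmetric e ->
  4 * #|extremal p q e| <= #|T| - 3.
Proof.
move=> p_inj q_inj e_anti; set B := extremal _ _ _.
pose f (u : T * 'I_4) := p u.1 + u.2.
have f_inj : {in setX B [set: 'I_4] &, injective f}.
  move=> [x i] [z j]; rewrite !inE !andbT /= /f /= => Bx Bz fE.
  have xz : x = z.
    case/and3P: Bx => _ _ /forallP/(_ z)/implyP ezx.
    case/and3P: Bz => _ _ /forallP/(_ x)/implyP exz.
    have := ltn_ord i; have := ltn_ord j => ? ?.
    by apply/q_inj/e_anti/andP; split; [apply: exz | apply: ezx];
      rewrite /near; lia.
  by move: fE; rewrite xz => /addnI/val_inj->.
have -> : 4 * #|B| = #|setX B [set: 'I_4]| by rewrite cardsX cardsT card_ord mulnC.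
rewrite cardE -(size_map f).
rewrite -(size_iota 3 (_ - 3)); apply: uniq_leq_size.
  rewrite map_inj_in_uniq ?enum_uniq // => u v.
  by rewrite !mem_enum; exact: f_inj.
move=> _ /mapP[[x i] + ->]; rewrite mem_enum mem_iota !inE andbT /f /=.
by case/and3P=> ? ? _; have := ltn_ord i; lia.
Qed.

Definition locally_extremal p q := extremal p q leq :|: extremal p q geq.

Lemma card_locally_extremal p q :
  injective p -> injective q -> 0 < #|T| -> 2 * #|locally_extremal p q| < #|T|.
Proof.
move=> p_inj q_inj; have geq_anti : antisymmetric geq by move=> m n /=; lia.
have := card_extremal p_inj q_inj anti_leq.
have := card_extremal p_inj q_inj geq_anti.
by have [+ _] := leq_card_setU (extremal p q leq) (extremal p q geq);
  rewrite /locally_extremal; lia.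
Qed.

Definition determines_crossing_or_side p q x (S : {set T}) :=
  forall z z', z != x -> z' != x -> z \notin S -> z' \notin S ->
    {in S, forall s, crossing p q s z = crossing p q s z'} ->
  crossing p q x z = crossing p q x z' \/ (p x < p z) = (p x < p z').

Lemma ex_pos p (p_inj : injective p) (p_lt : forall x, p x < #|T|) i :
  i < #|T| -> exists x, p x = i.
Proof.
move=> i_lt; have g_inj : injective (fun x => Ordinal (p_lt x)).
  by move=> x z [] /p_inj.
have [|g gK fK] := inj_card_bij g_inj; first by rewrite card_ord.
by exists (g (Ordinal i_lt)); have [] := congr1 val (fK (Ordinal i_lt)).
Qed.

(** Let [a] and [b] be the points just before and after [x]. If they lie on different vertical sides
    of [x], they serve. Otherwise one is replaced by a near point on the other vertical side, [u]
    above or [v] below; the span is then at most 3 + 1. *)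
Lemma monotone_triple p q x :
  injective p -> injective q -> (forall x, p x < #|T|) ->
  3 <= p x -> p x + 3 < #|T| -> x \notin locally_extremal p q ->
  exists l r, [/\ p l < p x < p r, p r <= p l + 4 &
                  q l < q x < q r \/ q r < q x < q l].
Proof.
move=> p_inj q_inj p_lt x3 xn; rewrite !inE x3 xn /= negb_or.
case/andP=> /forallPn[u]; rewrite negb_imply => /andP[/andP[u1 u2] qu].
case/forallPn=> v; rewrite negb_imply => /andP[/andP[v1 v2] qv].
have ux : p u <> p x by move/p_inj=> ux; move: qu; rewrite ux leqnn.
have vx : p v <> p x by move/p_inj=> vx; move: qv; rewrite vx /= leqnn.
have [|a pa] := @ex_pos p p_inj p_lt (p x).-1; first by lia.
have [|b pb] := @ex_pos p p_inj p_lt (p x).+1; first by lia.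
have qa : q a <> q x by move/q_inj=> ax; move: pa; rewrite ax; lia.
have qb : q b <> q x by move/q_inj=> bx; move: pb; rewrite bx; lia.
have [qax|qax] := ltnP (q a) (q x); have [qbx|qbx] := ltnP (q b) (q x).
- by have [?|?] := ltnP (p u) (p x); [exists u, b | exists a, u]; split; lia.
- by exists a, b; split; lia.
- by exists a, b; split; lia.
- by have [?|?] := ltnP (p v) (p x); [exists v, b | exists a, v];
    move: qv => /= qv; split; lia.
Qed.

Lemma ex_determining_set p q x :
  injective p -> injective q -> (forall x, p x < #|T|) ->
  x \notin locally_extremal p q ->
  exists S : {set T}, [/\ x \notin S, #|S| <= 4 &
                          determines_crossing_or_side p q x S].
Proof.
move=> p_inj q_inj p_lt xloc.
have neq_pos z : z != x -> p z <> p x by move=> /eqP zx /p_inj.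
have [x3|x3] := ltnP (p x) 3.
  (* At most two points precede [x], and all remaining ones lie on its right. *)
  exists [set z | p z < p x]; split; first by rewrite inE ltnn.
    by apply: (@card_window p _ 0) => // z; rewrite inE; lia.
  by move=> z z' /neq_pos zx /neq_pos z'x; rewrite !inE => ? ? _; right; lia.
have [xn|xn] := ltnP (p x + 3) #|T|; last first.
  exists [set z | p x < p z]; split; first by rewrite inE ltnn.
    apply: (@card_window p _ (p x)) => // z; rewrite inE.
    by have := p_lt z; lia.
  by move=> z z' /neq_pos zx /neq_pos z'x; rewrite !inE => ? ? _; right; lia.
have [l [r [/andP[lx xr] lr mono]]] := monotone_triple p_inj q_inj p_lt x3 xn xloc.
pose W := [set z | p l <= p z <= p r].
exists (W :\ x); split; first by rewrite !inE eqxx.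
  have: #|W| <= 5 by apply: (@card_window p _ (p l)) => // z; rewrite inE; lia.
  have xW : x \in W by rewrite inE; lia.
  by rewrite (cardsD1 x) xW.
move=> z z' zx z'x; rewrite !inE zx z'x /= => zW z'W adjE.
have lW : l \in W :\ x.
  by rewrite !inE; apply/andP; split; [apply/eqP=> e; move: lx; rewrite e|]; lia.
have rW : r \in W :\ x.
  by rewrite !inE; apply/andP; split; [apply/eqP=> e; move: xr; rewrite e|]; lia.
move: (adjE l lW) (adjE r rW); rewrite /crossing; clear adjE lW rW.
(* If [z] and [z'] lie on different sides of the strip, equal adjacencies to [l] and [r] put one
   above both and the other below both. The ordinate of [x] is between, so the adjacencies to [x]
   agree as well. *)
have [] := ltnP (p l) (p z); have [] := ltnP (p l) (p z');
have [] := ltnP (p r) (p z); have [] := ltnP (p r) (p z');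
have [] := ltnP (p x) (p z); have [] := ltnP (p x) (p z'); try lia;
move=> *; by [right | left; lia].
Qed.

End Points.

(** Allowing any injective coordinates, with gaps, makes this apply to every induced subgraph by
    restriction. *)
Lemma ex_vertex_functionality_le8 (G : sgraph) (p q : G -> nat) :
  injective p -> injective q -> (forall x z, adj x z = crossing p q x z) ->
  exists x : G, vertex_functionality x <= 8.
Proof.
move=> p_inj q_inj adjE; set p' := rank p; set q' := rank q.
have p'_inj : injective p' by exact: rank_inj.
have q'_inj : injective q' by exact: rank_inj.
have crE x z : adj x z = crossing p' q' x z by rewrite adjE /crossing !rank_ltE.
have crE' x z : adj x z = crossing q' p' x z by rewrite crE /crossing addbC.
have /card_gt0P[x] :
    0 < #|~: (locally_extremal p' q' :|: locally_extremal q' p')|.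
  have := card_locally_extremal p'_inj q'_inj (vertex_nonempty G).
  have := card_locally_extremal q'_inj p'_inj (vertex_nonempty G).
  have [+ _] := leq_card_setU (locally_extremal p' q') (locally_extremal q' p').
  by have := cardsC (locally_extremal p' q' :|: locally_extremal q' p'); lia.
rewrite in_setC in_setU negb_or => /andP[x_p x_q]; exists x.
have [S [xS cardS detS]] :=
  ex_determining_set p'_inj q'_inj (@rank_lt_card _ p) x_p.
have [R [xR cardR detR]] :=
  ex_determining_set q'_inj p'_inj (@rank_lt_card _ q) x_q.
apply: (@leq_trans #|S :|: R|); last by have [+ _] := leq_card_setU S R; lia.
apply: vertex_functionality_le_card; first by rewrite inE negb_or xS.
move=> z z' zx z'x; rewrite !inE !negb_or.
move=> /andP[zS zR] /andP[z'S z'R] adj_zz'.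
have [|crS|sideS] := detS z z' zx z'x zS z'S.
- by move=> s sS; rewrite -!crE; apply: adj_zz'; rewrite inE sS.
- by rewrite !crE.
have [|crR|sideR] := detR z z' zx z'x zR z'R.
- by move=> s sR; rewrite -!crE'; apply: adj_zz'; rewrite inE sR orbT.
- by rewrite !crE'.
by rewrite !crE /crossing sideS sideR.
Qed.

Lemma perm_adjE n (s : 'S_n.+1) (i j : 'I_n.+1) :
  perm_adj s i j = crossing (fun k => nat_of_ord k) (fun k => nat_of_ord (s k)) i j.
Proof.
rewrite /perm_adj /crossing.
have [->|ij] := eqVneq i j; first by rewrite GRing.subrr GRing.mul0r !ltnn.
have sij : val (s i) <> val (s j).
  by move/val_inj/perm_inj=> e; rewrite e eqxx in ij.
have {}ij : val i <> val j by move/val_inj=> e; rewrite e eqxx in ij.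
by move: ij sij => /=; have [] := ltnP i j; have [] := ltnP (s i) (s j) => /=; nia.
Qed.

Theorem theorem4 (G : sgraph) : is_permutation_graph G -> functionality G <= 8.
Proof.
move=> [n [s [f f_bij adj_f]]]; apply/bigmax_leqP => S _.
have f_inj := bij_inj f_bij.
have [||x z|x x8] := @ex_vertex_functionality_le8 (induced S)
  (fun x => nat_of_ord (f (val x))) (fun x => nat_of_ord (s (f (val x)))).
- by move=> x z /ord_inj/f_inj/val_inj.
- by move=> x z /ord_inj/perm_inj/f_inj/val_inj.
- exact: etrans (esym (adj_f _ _)) (perm_adjE _ _ _).
rewrite /min_vertex_functionality; case: ex_minnP => m _ /(_ _ _)/leq_trans.
by apply; [apply/existsP; exists x | exact: x8].
Qed.
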